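(* Assume that $\mathbb E_\mu X^2<\infty$, $\mathbb E_\mu Y_i^2<\infty$ for $i=1,\dots,d-1$, and $\mathbb E_\mu L^2<\infty$. If the covariance matrix $\Sigma_\mu(X,\boldsymbol Y)$ is invertible, then for every $\delta>0$ the optimal value $$V_\mu(\delta)=\sup_{L'\ge 0}\left\{\mathbb E_\mu(L'X):\ \mathbb E_\mu L'=1,\ \mathbb E_\mu(L'-L)^2\le\delta,\ \mathbb E_\mu(L'\boldsymbol Y)=\mathbb E_\mu(L\boldsymbol Y)\right\}$$ (supremum over all measurable $L':\Omega\to[0,\infty)$ satisfying the stated constraints) satisfies $$V_\mu(\delta)\le \mathbb E X+\sqrt{\delta\,\frac{\det\{\Sigma_\mu(X,\boldsymbol Y)\}}{\det\{\Sigma_\mu(\boldsymbol Y)\}}},$$ and this holds with equality if and only if $$X-\mathbb E_\mu X-\mathrm{cov}_\mu(X,\boldsymbol Y)\,\Sigma_\mu(\boldsymbol Y)^{-1}(\boldsymbol Y-\mathbb E_\mu\boldsymbol Y)+\sqrt{\frac{\det\{\Sigma_\mu(X,\boldsymbol Y)\}}{\delta\det\{\Sigma_\mu(\boldsymbol Y)\}}}\;L\ \ge\ 0\qquad\mu\text{-a.s.}$$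
   Context: Let $d\ge 2$ and let $(X,\boldsymbol Y^\top)=(X,Y_1,\dots,Y_{d-1})$ be a real random vector on a measurable space $(\Omega,\mathcal F)$. Let $\mathbb P$ (the reference model) and $\mu$ (the dominating measure) be probability measures on $(\Omega,\mathcal F)$ with $\mathbb P\ll\mu$, and let $L=\mathrm d\mathbb P/\mathrm d\mu$ be the Radon--Nikodym derivative; it is assumed that $L$ is measurable with respect to $\sigma(X,\boldsymbol Y)$. $\mathbb E$ and $\mathbb E_\mu$ denote expectation under $\mathbb P$ and $\mu$, respectively. $\Sigma_\mu(X,\boldsymbol Y)$ is the $d\times d$ covariance matrix of $(X,\boldsymbol Y^\top)$ under $\mu$, $\Sigma_\mu(\boldsymbol Y)$ is the $(d-1)\times(d-1)$ covariance matrix of $\boldsymbol Y$ under $\mu$, and $\mathrm{cov}_\mu(X,\boldsymbol Y)$ is the row vector $(\mathrm{cov}_\mu(X,Y_1),\dots,\mathrm{cov}_\mu(X,Y_{d-1}))$ of covariances under $\mu$. *)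

(* Defs.v *)
From HB Require Import structures.
From mathcomp Require Import all_boot all_order all_algebra.
From mathcomp Require Import all_classical all_reals all_analysis.

Set Implicit Arguments.
Unset Strict Implicit.
Unset Printing Implicit Defensive.

Import Order.TTheory GRing.Theory Num.Theory.
Import numFieldNormedType.Exports.

Local Open Scope classical_set_scope.
Local Open Scope ring_scope.

Section second_order_structure.
Context {disp : measure_display} {T : measurableType disp} {R : realType}.
Implicit Types (mu : probability T R) (X : T -> R).

(* [fine] loses nothing on the square-integrable variables these moments are
   meant for. *)
Definition mean_vec mu (n : nat) (Y : 'I_n -> T -> R) : 'cV[R]_n :=
  \col_i fine 'E_mu[Y i]%E.

Definition cov_row mu X (n : nat) (Y : 'I_n -> T -> R) : 'rV[R]_n :=
  \row_j fine (covariance mu X (Y j)).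

Definition cov_mx mu (n : nat) (Y : 'I_n -> T -> R) : 'M[R]_n :=
  \matrix_(i, j) fine (covariance mu (Y i) (Y j)).

(* The vector (X, Y_1, ..., Y_n), with X at index 0. *)
Definition cons_vec X (n : nat) (Y : 'I_n -> T -> R) : 'I_n.+1 -> T -> R :=
  fun i => oapp Y X (unlift ord0 i).

(* Residual of the best affine predictor of X from Y under mu. *)
Definition residual mu X (n : nat) (Y : 'I_n -> T -> R) : T -> R :=
  fun w => X w - fine 'E_mu[X]%E
    - (cov_row mu X Y *m invmx (cov_mx mu Y)
         *m ((\col_i Y i w) - mean_vec mu Y)) 0 0.

End second_order_structure.

Section optimal_value.
Context {disp : measure_display} {T : measurableType disp} {R : realType}.
Variables (mu : probability T R) (L : T -> R) (n : nat) (Y : 'I_n -> T -> R).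

Definition feasible (delta : R) : set {RV mu >-> R} :=
  [set L' : {RV mu >-> R} |
    [/\ forall w, 0 <= L' w,
        'E_mu[L']%E = 1%E,
        ('E_mu[fun w => ((L' w - L w) ^+ 2)%R] <= delta%:E)%E
      & forall i,
          'E_mu[fun w => (L' w * Y i w)%R]%E =
          'E_mu[fun w => (L w * Y i w)%R]%E] ].

(* All expectations in [feasible] and below are of integrable functions when
   L, X and the Y i are square-integrable, since L' - L then is as well. *)
Definition opt_value (X : T -> R) (delta : R) : \bar R :=
  ereal_sup [set 'E_mu[fun w => (L' w * X w)%R]%E | L' in feasible delta].

End optimal_value.

(* Main.v *)
Require Import Defs.
From HB Require Import structures.
From mathcomp Require Import all_boot all_order all_algebra.
From mathcomp Require Import all_classical all_reals all_analysis.
From mathcomp Require Import measurable_realfun ring lra.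

Set Implicit Arguments.
Unset Strict Implicit.
Unset Printing Implicit Defensive.

Import Order.TTheory GRing.Theory Num.Theory.
Import numFieldNormedType.Exports.

Local Open Scope classical_set_scope.
Local Open Scope charge_scope.
Local Open Scope ring_scope.

(** Write [<f, g>] for the expectation of [f g] under [mu], on square-integrable
    variables, and let [Z] be the residual of [X] after affine regression on
    [Y]. [Z] is orthogonal to the constants and to every [Y i], and a Schur
    complement gives [<Z, Z> = detXY / detY], which is positive because
    [cov_mx mu (cons_vec X Y)] is invertible. The invertibility of
    [cov_mx mu Y], on which regression relies, is inherited from it
    ([cov_mx_unit_sub]): a kernel vector of a covariance matrix is exactly a
    linear combination with zero variance.

    A feasible [L'] is [L + D] with [<D, D> <= delta] and [D] orthogonal to [1]
    and to [Y]; such a [D] cannot tell [X] from [Z], so the objective is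
    [<L, X> + <D, Z>], where [<L, X> = 'E_P[X]] by change of variables. With
    [k = sqrt (detXY / (delta * detY))], so that [k^2 delta = <Z, Z>],
    everything follows from one completed square ([square_perturbation]):
    [|k D - Z|^2 = k^2 <D, D> - 2 k <D, Z> + k^2 delta].

    - Its nonnegativity gives [<D, Z> <= delta k], which is the bound.
    - Put [W = Z + k L]. If [W >= 0] almost surely then [L' = W^+ / k] is almost
      surely [L + Z / k]; it is feasible and annihilates the square up to a null
      set, so it attains the bound.
    - If the bound is the supremum, feasible [L'] make the square arbitrarily
      small. But [k D - Z = k L' - W] with [k L' >= 0], so the square dominates
      the second moment of the negative part of [W], which is therefore zero.
      No maximizer has to be extracted by compactness. *)

(** * The L2 pairing of a probability space *)

Section inner_product.
Context {disp : measure_display} {T : measurableType disp} {R : realType}.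
Variable mu : probability T R.
Implicit Types f g h : T -> R.

Local Notation L2 := (Lfun mu 2%:E).

(** A real number on [L2], where the product is integrable. *)
Definition inner f g : R := fine 'E_mu[fun w => (f w * g w)%R]%E.

Lemma Lfun2_measurable f : f \in L2 -> measurable_fun setT f.
Proof. by rewrite inE => /andP[]; rewrite inE. Qed.

Lemma Lfun2_of_moment f : measurable_fun setT f ->
  ('E_mu[fun w => (f w ^+ 2)%R] < +oo)%E -> f \in L2.
Proof.
move=> mf; rewrite unlock => ff.
rewrite inE; apply/andP; split; rewrite inE//= /finite_norm unlock /Lnorm.
rewrite poweR_lty//=.
by under eq_integral => x _ do rewrite powR_mulrn// real_normK ?num_real//.
Qed.

Lemma Lfun2_cst (a : R) : (fun=> a) \in L2.
Proof. exact: (Lfun_cst mu a 2). Qed.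

Lemma Lfun2Z a f : f \in L2 -> (fun w => a * f w) \in L2.
Proof.
move=> f2; have -> : (fun w => a * f w) = a \o* f by apply/funext => w /=; ring.
by apply: Lfun_scale => //; rewrite ler1n.
Qed.

Lemma Lfun2D f g : f \in L2 -> g \in L2 -> (fun w => f w + g w) \in L2.
Proof. by move=> f2 g2; rewrite (rpredD f2 g2) ?lee1n. Qed.

Lemma Lfun2_sum n (v : 'I_n -> R) (F : 'I_n -> T -> R) :
  (forall i, F i \in L2) -> (fun w => \sum_i v i * F i w) \in L2.
Proof.
elim: n v F => [|n IH] v F F2.
  by under eq_fun do rewrite big_ord0; exact: Lfun2_cst.
under eq_fun do rewrite big_ord_recl.
by apply: Lfun2D; [exact: Lfun2Z|exact: IH].
Qed.

Lemma Lfun2B f g : f \in L2 -> g \in L2 -> (fun w => f w - g w) \in L2.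
Proof. by move=> f2 g2; rewrite (rpredB f2 g2) ?lee1n. Qed.

Lemma expectation_inner f g : f \in L2 -> g \in L2 ->
  'E_mu[fun w => (f w * g w)%R]%E = (inner f g)%:E.
Proof.
by move=> f2 g2; rewrite fineK// expectation_fin_num//; exact: Lfun2_mul_Lfun1.
Qed.

Lemma innerC f g : inner f g = inner g f.
Proof.
by congr (fine 'E_mu[_]%E); apply/funext => w /=; rewrite mulrC.
Qed.

Lemma innerDl f g h : f \in L2 -> g \in L2 -> h \in L2 ->
  inner (fun w => f w + g w) h = inner f h + inner g h.
Proof.
move=> f2 g2 h2; apply: EFin_inj; rewrite EFinD.
rewrite -!expectation_inner ?Lfun2D// -expectationD ?Lfun2_mul_Lfun1//.
by congr ('E_mu[_]%E); apply/funext => w /=; ring.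
Qed.

Lemma innerZl a f g : f \in L2 -> g \in L2 ->
  inner (fun w => a * f w) g = a * inner f g.
Proof.
move=> f2 g2; apply: EFin_inj; rewrite EFinM.
rewrite -!expectation_inner ?Lfun2Z// -expectationZl ?Lfun2_mul_Lfun1//.
by congr ('E_mu[_]%E); apply/funext => w /=; ring.
Qed.

Lemma innerBl f g h : f \in L2 -> g \in L2 -> h \in L2 ->
  inner (fun w => f w - g w) h = inner f h - inner g h.
Proof.
move=> f2 g2 h2; apply: EFin_inj; rewrite EFinB.
rewrite -!expectation_inner ?Lfun2B// -expectationB ?Lfun2_mul_Lfun1//.
by congr ('E_mu[_]%E); apply/funext => w /=; ring.
Qed.

Lemma innerDr f g h : f \in L2 -> g \in L2 -> h \in L2 ->
  inner h (fun w => f w + g w) = inner h f + inner h g.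
Proof. by move=> *; rewrite innerC innerDl// !(innerC h). Qed.

Lemma innerZr a f g : f \in L2 -> g \in L2 ->
  inner g (fun w => a * f w) = a * inner g f.
Proof. by move=> *; rewrite innerC innerZl// (innerC g). Qed.

Lemma innerBr f g h : f \in L2 -> g \in L2 -> h \in L2 ->
  inner h (fun w => f w - g w) = inner h f - inner h g.
Proof. by move=> *; rewrite innerC innerBl// !(innerC h). Qed.

Lemma inner_sumr n (v : 'I_n -> R) (F : 'I_n -> T -> R) f :
    f \in L2 -> (forall i, F i \in L2) ->
  inner f (fun w => \sum_i v i * F i w) = \sum_i v i * inner f (F i).
Proof.
elim: n v F => [|n IH] v F f2 F2.
  rewrite big_ord0; apply: (etrans _ (mul0r (inner f f))); rewrite -innerZr//.
  by congr (inner _ _); apply/funext => w; rewrite big_ord0 mul0r.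
rewrite big_ord_recl -IH// -innerZr// -innerDr ?Lfun2Z ?Lfun2_sum//.
by congr (inner _ _); apply/funext => w; rewrite big_ord_recl.
Qed.

Lemma inner_ge0 f : 0 <= inner f f.
Proof. by apply/fine_ge0/expectation_ge0 => w /=; rewrite -expr2 sqr_ge0. Qed.

(** Once [|f|^2 = 0], the nonnegative quantity [|t f + g|^2] is affine in [t],
    so its slope vanishes. *)
Lemma inner_null f g : f \in L2 -> g \in L2 -> inner f f = 0 -> inner f g = 0.
Proof.
move=> f2 g2 f0.
have pos t : 0 <= 2 * t * inner f g + inner g g.
  have := inner_ge0 (fun w => t * f w + g w).
  rewrite innerDl ?Lfun2D ?Lfun2Z// !innerDr ?Lfun2Z//.
  by rewrite !(innerZl, innerZr) ?Lfun2Z// (innerC g f) f0 => ?; lra.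
apply/eqP; case: eqVneq => // fg0.
(* At this [t] the affine function takes the value [-1]. *)
have := pos (- (inner g g + 1) / (2 * inner f g)).
have -> : 2 * (- (inner g g + 1) / (2 * inner f g)) * inner f g =
  - (inner g g + 1) by field.
lra.
Qed.

Lemma expectation_ae_eq f g :
    measurable_fun setT f -> measurable_fun setT g ->
  {ae mu, forall w, f w = g w} -> 'E_mu[f]%E = 'E_mu[g]%E.
Proof.
move=> mf mg fg; rewrite unlock; apply: ae_eq_integral => //.
- exact/measurable_EFinP.
- exact/measurable_EFinP.
by apply: filterS fg => w /= -> _.
Qed.

Lemma expectation_eq0_ae f : measurable_fun setT f -> (forall w, 0 <= f w) ->
  'E_mu[f]%E = 0%E -> {ae mu, forall w, f w = 0}.
Proof.
move=> mf f0; rewrite unlock => If.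
have /ae_eq_integral_abs : measurable_fun setT (EFin \o f).
  exact/measurable_EFinP.
move=> /(_ mu measurableT)[+ _].
under eq_integral do rewrite gee0_abs ?lee_fin//.
by move=> /(_ If); apply: filterS => w /= /(_ I) [].
Qed.

Definition mean f : R := fine 'E_mu[f]%E.
Definition centered f : T -> R := fun w => f w - mean f.

Lemma Lfun2_centered f : f \in L2 -> centered f \in L2.
Proof. by move=> f2; apply: Lfun2B => //; exact: Lfun2_cst. Qed.

Lemma inner_cst a f : f \in L2 -> inner (fun=> a) f = a * mean f.
Proof.
move=> f2.
have -> : mean f = inner (fun=> 1) f.
  by congr (fine 'E_mu[_]%E); apply/funext => w; rewrite mul1r.
rewrite -innerZl//; last exact: Lfun2_cst.
by congr (inner _ _); apply/funext => w; rewrite mulr1.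
Qed.

Lemma mean_centered f : f \in L2 -> mean (centered f) = 0.
Proof.
move=> f2; rewrite -[LHS]mul1r -inner_cst ?Lfun2_centered//.
rewrite innerBr ?Lfun2_cst// !inner_cst ?Lfun2_cst//.
by rewrite {2}/mean expectation_cst/=; lra.
Qed.

Lemma fine_covariance f g :
  fine (covariance mu f g) = inner (centered f) (centered g).
Proof. by rewrite unlock. Qed.

Lemma inner_centeredr f g : f \in L2 -> g \in L2 -> mean f = 0 ->
  inner f (centered g) = inner f g.
Proof.
move=> f2 g2 f0; rewrite innerBr ?Lfun2_cst// (innerC f (fun=> mean g)).
by rewrite inner_cst// f0 mulr0 subr0.
Qed.
End inner_product.

(** * Affine regression and covariance determinants *)

Section regression.
Context {disp : measure_display} {T : measurableType disp} {R : realType}.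
Variables (mu : probability T R).
Local Notation L2 := (Lfun mu 2%:E).
Local Notation inner := (inner mu).
Local Notation centered := (centered mu).

Lemma inner_centered_lincomb n (F : 'I_n -> T -> R) (v : 'rV[R]_n) g :
    (forall i, F i \in L2) -> g \in L2 ->
  inner (centered g) (fun w => \sum_i v 0 i * centered (F i) w) =
  \sum_i v 0 i * fine (covariance mu (F i) g).
Proof.
move=> F2 g2; rewrite inner_sumr ?Lfun2_centered//; last first.
  by move=> i; rewrite Lfun2_centered.
by apply: eq_bigr => i _; rewrite fine_covariance innerC.
Qed.

(** [v S v^T] is the variance of the combination [v], and a vector of zero
    norm is orthogonal to everything. *)
Lemma mulmx_cov_mx0 n (F : 'I_n -> T -> R) (v : 'rV[R]_n) :
    (forall i, F i \in L2) ->
  let f := (fun w => \sum_i v 0 i * centered (F i) w) in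
  v *m cov_mx mu F = 0 <-> inner f f = 0.
Proof.
move=> F2 f.
have f2 : f \in L2 by apply: Lfun2_sum => i; exact: Lfun2_centered.
have vF j : (v *m cov_mx mu F) 0 j = inner f (centered (F j)).
  rewrite innerC inner_centered_lincomb// mxE; apply: eq_bigr => i _.
  by rewrite mxE.
split=> [vF0|f0].
  rewrite {2}/f inner_sumr// ?big1// => i; last exact: Lfun2_centered.
  by move=> _; rewrite -vF vF0 mxE mulr0.
by apply/rowP => j; rewrite vF mxE inner_null// Lfun2_centered.
Qed.

Lemma cons_vec_lift X n (Y : 'I_n -> T -> R) i :
  cons_vec X Y (lift ord0 i) = Y i.
Proof. by rewrite /cons_vec liftK. Qed.

Lemma cons_vec0 X n (Y : 'I_n -> T -> R) : cons_vec X Y ord0 = X.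
Proof. by rewrite /cons_vec unlift_none. Qed.

(** A kernel vector for [Y], padded with a zero coefficient for [X], gives the
    same variable of zero variance, hence a kernel vector for [(X, Y)]. *)
Lemma cov_mx_unit_sub X n (Y : 'I_n -> T -> R) :
    X \in L2 -> (forall i, Y i \in L2) ->
  cov_mx mu (cons_vec X Y) \in unitmx -> cov_mx mu Y \in unitmx.
Proof.
move=> X2 Y2; apply: contraTT; rewrite !unitmxE !unitfE !negbK => /det0P[v v0].
move=> /mulmx_cov_mx0 - /(_ Y2) vY0; apply/det0P.
exists (row_mx (0 : 'rV_1) v).
  apply: contraNneq v0 => v0; rewrite -[v](row_mxKr (0 : 'rV_1)) v0.
  by apply/eqP/rowP => i; rewrite !mxE.
apply/mulmx_cov_mx0 => [i|].
  by rewrite /cons_vec; case: unliftP => //=.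
rewrite -[RHS]vY0.
have -> : (fun w => \sum_i (row_mx (0 : 'rV_1) v) 0 i
      * centered (cons_vec X Y i) w) =
  (fun w => \sum_i v 0 i * centered (Y i) w); last by [].
apply/funext => w; rewrite big_split_ord/= big_ord1.
rewrite row_mxEl mxE mul0r add0r; apply: eq_bigr => i _.
by rewrite row_mxEr rshift1 cons_vec_lift.
Qed.

Lemma cov_mx_cons X n (Y : 'I_n -> T -> R) :
  cov_mx mu (cons_vec X Y) =
  block_mx ((fine (covariance mu X X))%:M) (cov_row mu X Y)
           ((cov_row mu X Y)^T) (cov_mx mu Y).
Proof.
rewrite -[LHS](@submxK _ 1 n 1 n).
apply: (f_equal4 (@block_mx R 1 n 1 n)); apply/matrixP => i j;
  rewrite !mxE ?ord1 ?lshift0 ?rshift1 ?cons_vec0 ?cons_vec_lift ?mulr1n//.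
by rewrite covarianceC.
Qed.

(** Left multiplication by the unitriangular matrix that subtracts from [X] its
    regression on [Y] clears the upper right block. *)
Lemma det_cov_mx_cons X n (Y : 'I_n -> T -> R) : cov_mx mu Y \in unitmx ->
  \det (cov_mx mu (cons_vec X Y)) =
  (fine (covariance mu X X)
    - (cov_row mu X Y *m invmx (cov_mx mu Y) *m (cov_row mu X Y)^T) 0 0)
  * \det (cov_mx mu Y).
Proof.
move=> uY; set b := cov_row mu X Y; set S := cov_mx mu Y.
set a := fine _.
pose U : 'M[R]_(1 + n) := block_mx (1%:M) (- (b *m invmx S)) 0 (1%:M).
have US : U *m cov_mx mu (cons_vec X Y) =
    block_mx (a%:M - b *m invmx S *m b^T) 0 (b^T) S.
  rewrite cov_mx_cons (mulmx_block (n1 := 1) (n2 := n) (p1 := 1)).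
  rewrite !mul1mx !mul0mx !add0r !mulNmx.
  by rewrite (mulmxKV uY) subrr.
have := congr1 determinant US.
rewrite det_mulmx det_ublock !det1 !mul1r => ->.
by rewrite det_lblock det_mx11 !mxE eqxx mulr1n.
Qed.

Variables (X : T -> R) (n : nat) (Y : 'I_n -> T -> R).
Hypotheses (X2 : X \in L2) (Y2 : forall i, Y i \in L2).
Local Notation Z := (residual mu X Y).
Local Notation a := (cov_row mu X Y *m invmx (cov_mx mu Y)).

Lemma residualE :
  Z = fun w => centered X w - \sum_i a 0 i * centered (Y i) w.
Proof.
apply/funext => w; rewrite /residual mxE; congr (_ - _).
by apply: eq_bigr => i _; rewrite !mxE.
Qed.

Let cX2 := Lfun2_centered X2.
Let cY2 i := Lfun2_centered (Y2 i).
Let Ysum2 : (fun w => \sum_i a 0 i * centered (Y i) w) \in L2.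
Proof. exact: Lfun2_sum. Qed.

Lemma Lfun2_residual : Z \in L2.
Proof. by rewrite residualE Lfun2B. Qed.

(** The normal equations of the regression. *)
Lemma inner_residual_cov j : cov_mx mu Y \in unitmx ->
  inner Z (centered (Y j)) = 0.
Proof.
move=> uY; rewrite residualE innerBl// (innerC _ (fun w => \sum_i _)).
rewrite inner_centered_lincomb// -fine_covariance.
have := congr1 (fun A : 'rV_n => A 0 j) (mulmxKV uY (cov_row mu X Y)).
rewrite !mxE => <-; apply/eqP; rewrite subr_eq0; apply/eqP.
by apply: eq_bigr => i _; rewrite [cov_mx _ _ _ _]mxE.
Qed.

(** By orthogonality, [<Z, Z>] is [<Z, X - E X>], which is the Schur complement
    of [cov_mx mu Y]. *)
Lemma inner_residual : cov_mx mu Y \in unitmx ->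
  inner Z Z = \det (cov_mx mu (cons_vec X Y)) / \det (cov_mx mu Y).
Proof.
move=> uY; rewrite det_cov_mx_cons// mulfK; last by rewrite -unitfE -unitmxE.
rewrite {2}residualE innerBr ?Lfun2_residual//.
rewrite inner_sumr ?Lfun2_residual// [X in _ - X]big1 => [|j _]; last first.
  by rewrite inner_residual_cov// mulr0.
rewrite subr0 {1}residualE innerBl// (innerC _ (fun w => \sum_i _)).
rewrite inner_centered_lincomb// -fine_covariance; congr (_ - _).
by rewrite [RHS]mxE; apply: eq_bigr => i _; rewrite !mxE covarianceC.
Qed.

Lemma mean_residual : mean mu Z = 0.
Proof.
rewrite -[LHS]mul1r -inner_cst ?Lfun2_residual// residualE innerBr ?Lfun2_cst//.
rewrite inner_sumr ?Lfun2_cst// inner_cst// mean_centered// mulr0 big1 ?subrr//.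
by move=> i _; rewrite inner_cst// mean_centered// !mulr0.
Qed.

(** The constraints on a perturbation make it blind to everything in [X] that
    is affine in [Y]. *)
Lemma inner_perturbation D : D \in L2 -> mean mu D = 0 ->
  (forall i, inner D (Y i) = 0) -> inner D X = inner D Z.
Proof.
move=> D2 D0 DY; rewrite residualE innerBr// inner_centeredr//.
rewrite inner_sumr// big1 ?subr0// => i _.
by rewrite inner_centeredr// DY mulr0.
Qed.

End regression.

(** * Expectation under a change of measure *)

Section radon_nikodym.
Context {disp : measure_display} {T : measurableType disp} {R : realType}.
Variables (P mu : probability T R) (hPmu : P `<< mu) (L : T -> R).
Hypotheses (mL : measurable_fun setT L)
  (hL : ae_eq mu setT (EFin \o L) ('d (charge_of_finite_measure P) '/d mu)).

Lemma mean_density : 'E_mu[L]%E = 1%E.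
Proof.
rewrite -(probability_setT P).
rewrite -[RHS]/(charge_of_finite_measure P setT).
rewrite (Radon_Nikodym_integral (mu := mu)
  (nu := charge_of_finite_measure P))//.
rewrite unlock; apply: ae_eq_integral => //.
exact/measurable_EFinP.
Qed.

(** Change of variables asks for [X] to be integrable under [P]. That is read off
    the integrability of [L X] under [mu], by changing variables first in the
    absolute value of [X], where nonnegativity suffices; the nonnegative
    representative of the density serves for this. *)
Lemma expectation_density X :
    X \in Lfun mu 2%:E -> L \in Lfun mu 2%:E ->
  'E_P[X]%E = (inner mu L X)%:E.
Proof.
move=> X2 L2.
have mX := Lfun2_measurable X2.
pose f := Radon_Nikodym_SigmaFinite.f P mu.
have mf : measurable_fun setT f.
  exact/measurable_int/Radon_Nikodym_SigmaFinite.f_integrable.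
have fL : ae_eq mu setT f (EFin \o L).
  apply: (ae_eq_trans (ae_eq_Radon_Nikodym_SigmaFinite hPmu measurableT)).
  exact: ae_eq_sym.
have LX1 : (L \* X)%R \in Lfun mu 1 by exact: Lfun2_mul_Lfun1.
have iX : P.-integrable setT (EFin \o X).
  apply/integrableP; split; first exact/measurable_EFinP.
  rewrite -(Radon_Nikodym_SigmaFinite.change_of_variables hPmu)//=; last first.
    by do 2 apply: measurableT_comp => //.
  move/Lfun1_integrable/integrableP : LX1 => [_].
  apply: le_lt_trans; rewrite le_eqVlt; apply/orP; left; apply/eqP.
  apply: ae_eq_integral => //.
  - apply: emeasurable_funM => //.
    by do 2 apply: measurableT_comp => //.
  - do 2 apply: measurableT_comp => //.
    exact: measurable_funM.
  - have f0 := Radon_Nikodym_SigmaFinite.f_ge0 hPmu.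
    apply: filterS fL => w /= fw _; rewrite -/(f w).
    rewrite normrM EFinM muleC; congr (_ * _)%E.
    have := f0 w; rewrite -/(f w) fw//= lee_fin => L0.
    by rewrite ger0_norm.
rewrite -expectation_inner// !expectation.unlock.
rewrite -(Radon_Nikodym_change_of_variables hPmu measurableT iX).
apply: ae_eq_integral => //.
- by apply: emeasurable_funM => //; exact/measurable_EFinP.
- by apply/measurable_EFinP; exact: measurable_funM.
by apply: filterS hL => w /= Lw _; rewrite -Lw// EFinM muleC.
Qed.

End radon_nikodym.

(** * Perturbing the density along the residual *)

Section optimal_perturbation.
Context {disp : measure_display} {T : measurableType disp} {R : realType}.
Variables (mu : probability T R) (X Z L : T -> R).
Variables (n : nat) (Y : 'I_n -> T -> R).
Local Notation L2 := (Lfun mu 2%:E).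
Local Notation inner := (inner mu).
Hypotheses (X2 : X \in L2) (Y2 : forall i, Y i \in L2) (L2_L : L \in L2)
  (EL : 'E_mu[L]%E = 1%E).
(** Regression enters only through these properties of its residual [Z]: it is
    itself an admissible direction of perturbation, and it acts as [X] does on
    all such directions. *)
Hypotheses (Z2 : Z \in L2) (meanZ : mean mu Z = 0)
  (ZY : forall i, inner Z (Y i) = 0)
  (XZ : forall D, D \in L2 -> mean mu D = 0 ->
    (forall i, inner D (Y i) = 0) -> inner D X = inner D Z).
Variables (delta k : R).
Hypotheses (k0 : 0 < k) (hk : k ^+ 2 * delta = inner Z Z).

Let mL := Lfun2_measurable L2_L.
Let mX := Lfun2_measurable X2.
Let mZ := Lfun2_measurable Z2.

(** [k] times the maximizer [L + Z / k] of the problem without the sign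
    constraint. *)
Definition tilt : T -> R := fun w => Z w + k * L w.

Let tilt2 : tilt \in L2.
Proof. by apply: Lfun2D => //; exact: Lfun2Z. Qed.

Lemma square_perturbation D : D \in L2 ->
  inner (fun w => k * D w - Z w) (fun w => k * D w - Z w) =
  k ^+ 2 * inner D D - 2 * k * inner D Z + k ^+ 2 * delta.
Proof.
move=> D2; rewrite innerBl ?Lfun2B ?Lfun2Z// !innerBr ?Lfun2Z//.
by rewrite !(innerZl, innerZr) ?Lfun2Z// hk (innerC _ Z D); lra.
Qed.

Lemma feasibleP (L' : {RV mu >-> R}) : feasible L Y delta L' ->
  let D := fun w => L' w - L w in
  [/\ D \in L2, inner D D <= delta, mean mu D = 0 &
      forall i, inner D (Y i) = 0].
Proof.
move=> [_ EL' DD YE] D.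
have D2 : D \in L2.
  apply: Lfun2_of_moment; last exact: le_lt_trans DD (ltry _).
  exact: measurable_funB.
have L'2 : (L' : T -> R) \in L2.
  have -> : (L' : T -> R) = fun w => D w + L w.
    by apply/funext => w; rewrite /D subrK.
  exact: Lfun2D.
split=> //.
- by rewrite -lee_fin -expectation_inner.
- rewrite -[LHS]mul1r -inner_cst// innerBr ?Lfun2_cst// !inner_cst//.
  by rewrite /mean EL' EL subrr.
- move=> i; rewrite innerBl//; apply: EFin_inj; rewrite EFinB.
  by rewrite -!expectation_inner// YE expectation_inner// -EFinB subrr.
Qed.

Lemma objective_feasible (L' : {RV mu >-> R}) : feasible L Y delta L' ->
  'E_mu[fun w => (L' w * X w)%R]%E =
  (inner L X + inner (fun w => L' w - L w) Z)%:E.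
Proof.
move=> fL'; have [D2 _ D0 DY] := feasibleP fL'.
rewrite -XZ// -innerDl// -expectation_inner//; last first.
  exact: Lfun2D.
by congr ('E_mu[_]%E); apply/funext => w; rewrite subrKC.
Qed.

Lemma opt_value_le :
  (opt_value mu L Y X delta <= (inner L X + delta * k)%:E)%E.
Proof.
apply: ge_ereal_sup => _ [L' fL' <-]; rewrite objective_feasible//.
have [D2 DD _ _] := feasibleP fL'.
rewrite lee_fin lerD2l.
have := inner_ge0 mu (fun w => k * (L' w - L w) - Z w).
rewrite square_perturbation//; set DZ := inner _ Z => sq0.
have : k ^+ 2 * inner (fun w => L' w - L w) (fun w => L' w - L w) <=
    k ^+ 2 * delta.
  by rewrite ler_pM2l ?exprn_gt0.
move=> kDD; rewrite -(ler_pM2l k0).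
by move: sq0 kDD; set DDk := k ^+ 2 * inner _ _; nra.
Qed.

(** Near-optimal feasible [L'] bring [k L'] close to [tilt] in mean square, while
    the distance from any nonnegative variable to [tilt] is at least the norm
    of its negative part. *)
Lemma tilt_ge0_of_attained :
  opt_value mu L Y X delta = (inner L X + delta * k)%:E ->
  {ae mu, forall w, 0 <= tilt w}.
Proof.
move=> opt.
have mW : measurable_fun setT tilt := Lfun2_measurable tilt2.
have mN : measurable_fun setT (fun w => (tilt^\- w) ^+ 2).
  by apply: measurable_funX; exact: measurable_funrneg.
suff N0 : 'E_mu[fun w => (tilt^\- w ^+ 2)%R]%E = 0%E.
  have := expectation_eq0_ae mN (fun w => sqr_ge0 _) N0.
  apply: filterS => w /= /eqP; rewrite sqrf_eq0 => /eqP N0w.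
  by rewrite leNgt; apply/negP => Ww; move: N0w; rewrite /funrneg max_l; lra.
apply/eqP; rewrite eq_le expectation_ge0 ?andbT; last first.
  by move=> w; exact: sqr_ge0.
apply/lee_addgt0Pr => e e0; rewrite add0e.
(* A gap of [e'] in the objective leaves at most [2 * k * e'] in the square. *)
pose e' := e / (2 * k).
have e'0 : 0 < e' by rewrite divr_gt0 ?mulr_gt0.
have opt_fin : opt_value mu L Y X delta \is a fin_num by rewrite opt.
have [_ [L' fL' <-]] := ub_ereal_sup_adherent e'0 opt_fin.
rewrite -/(opt_value mu L Y X delta) opt objective_feasible//.
rewrite -EFinB lte_fin => close.
have [D2 DD _ _] := feasibleP fL'.
have [L'0 _ _ _] := fL'.
set D := fun w => L' w - L w in D2 DD close.
have kD2 : (fun w => k * D w - Z w) \in L2.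
  by apply: Lfun2B => //; exact: Lfun2Z.
apply: (@le_trans _ _
  (inner (fun w => k * D w - Z w) (fun w => k * D w - Z w))%:E).
  rewrite -expectation_inner//; apply: expectation_le => //.
  - by apply: measurable_funM; exact: Lfun2_measurable kD2.
  - by move=> w; exact: sqr_ge0.
  - by move=> w; rewrite -expr2 sqr_ge0.
  apply: aeW => w; rewrite -expr2.
  (* Where [tilt] is negative, [k L' - tilt] is at least [- tilt]. *)
  have kL' : 0 <= k * L' w by rewrite mulr_ge0// ltW.
  have -> : k * D w - Z w = k * L' w - tilt w by rewrite /D /tilt; ring.
  rewrite /funrneg; have [tw|tw] := leP (- tilt w) 0.
    by rewrite expr0n sqr_ge0.
  by rewrite ler_sqr ?nnegrE; lra.
rewrite square_perturbation// lee_fin.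
have : k ^+ 2 * inner D D <= k ^+ 2 * delta by rewrite ler_pM2l ?exprn_gt0.
have -> : e = 2 * k * e' by rewrite /e'; field; rewrite gt_eqF.
have : k * (delta * k - e') < k * inner D Z by rewrite ltr_pM2l//; lra.
by set DDk := k ^+ 2 * inner _ _; nra.
Qed.

(** The maximizer is the positive part of [L + Z / k], since feasibility asks for
    nonnegativity everywhere and not only almost everywhere. *)
Lemma attained_of_tilt_ge0 :
  {ae mu, forall w, 0 <= tilt w} ->
  opt_value mu L Y X delta = (inner L X + delta * k)%:E.
Proof.
move=> W0; apply/eqP; rewrite eq_le opt_value_le/=.
pose S w := L w + k^-1 * Z w.
have S2 : S \in L2 by apply: Lfun2D => //; exact: Lfun2Z.
have mS := Lfun2_measurable S2.
have mSp : measurable_fun setT S^\+ by exact: measurable_funrpos.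
pose L' : {RV mu >-> R} := HB.pack S^\+ (isMeasurableFun.Build _ _ _ _ _ mSp).
have L'S : {ae mu, forall w, L' w = S w}.
  apply: filterS W0 => w /= W0w; apply/max_idPl.
  have -> : S w = k^-1 * tilt w by rewrite /S /tilt; field; rewrite gt_eqF.
  by rewrite mulr_ge0// invr_ge0 ltW.
have EL' g : measurable_fun setT g ->
    'E_mu[fun w => (L' w * g w)%R]%E = 'E_mu[fun w => (S w * g w)%R]%E.
  move=> mg; apply: expectation_ae_eq; [exact: measurable_funM..|].
  by apply: filterS L'S => w /= ->.
have iS g : g \in L2 -> inner S g = inner L g + k^-1 * inner Z g.
  by move=> g2; rewrite innerDl ?Lfun2Z// innerZl.
have fL' : feasible L Y delta L'.
  split=> [w||  |i].
  - exact: funrpos_ge0.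
  - rewrite (_ : 'E_mu[L']%E = 'E_mu[S]%E); last exact: expectation_ae_eq.
    have -> : S = fun w => S w * 1 by apply/funext => w; rewrite mulr1.
    rewrite expectation_inner ?Lfun2_cst// iS ?Lfun2_cst//.
    rewrite !(innerC _ _ (fun=> 1)) !inner_cst// meanZ /mean EL/=.
    by congr EFin; lra.
  - rewrite (_ : 'E_mu[_]%E = (k ^- 2 * inner Z Z)%:E).
      by rewrite -hk lee_fin mulrA mulVf ?mul1r// expf_neq0// gt_eqF.
    have -> : k ^- 2 * inner Z Z =
        inner (fun w => k^-1 * Z w) (fun w => k^-1 * Z w).
      by rewrite innerZl ?Lfun2Z// innerZr// mulrA -expr2 exprVn.
    rewrite -expectation_inner ?Lfun2Z//; apply: expectation_ae_eq.
    + apply: measurable_funX; exact: measurable_funB.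
    + by apply: measurable_funM; exact: measurable_funM.
    + by apply: filterS L'S => w /= ->; rewrite /S; ring.
  - rewrite EL'; last exact: Lfun2_measurable (Y2 i).
    by rewrite !expectation_inner// iS// ZY mulr0 addr0.
apply: (@le_trans _ _ 'E_mu[fun w => (L' w * X w)%R]%E); last first.
  by apply: ereal_sup_ubound; exists L'.
rewrite EL'//.
rewrite expectation_inner// iS// (XZ Z2 meanZ ZY).
rewrite -hk lee_fin lerD2l le_eqVlt; apply/orP; left; apply/eqP.
by field; rewrite gt_eqF.
Qed.

End optimal_perturbation.

(** * Worst-case expectation under moment constraints *)

Theorem theorem2 (disp : measure_display) (T : measurableType disp)
    (R : realType) (d : nat) (hd : (2 <= d)%N)
    (P mu : probability T R) (hPmu : P `<< mu)
    (X : {RV mu >-> R}) (Y : 'I_d.-1 -> {RV mu >-> R})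
    (L : {RV mu >-> R})
    (hL : ae_eq mu setT (EFin \o L)
            ('d (charge_of_finite_measure P) '/d mu))
    (hLXY : forall B : set R, measurable B ->
              g_sigma_preimage (cons_vec X Y) (L @^-1` B))
    (hX2 : ('E_mu[fun w => (X w ^+ 2)%R] < +oo)%E)
    (hY2 : forall i, ('E_mu[fun w => (Y i w ^+ 2)%R] < +oo)%E)
    (hL2 : ('E_mu[fun w => (L w ^+ 2)%R] < +oo)%E)
    (hSigma : cov_mx mu (cons_vec X Y) \in unitmx) :
  forall delta : R, 0 < delta ->
    let detXY := \det (cov_mx mu (cons_vec X Y)) in
    let detY := \det (cov_mx mu Y) in
    let bound := ('E_P[X] + (Num.sqrt (delta * (detXY / detY)))%:E)%E in
    (opt_value mu L Y X delta <= bound)%E /\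
    (opt_value mu L Y X delta = bound <->
     {ae mu, forall w,
        0 <= residual mu X Y w + Num.sqrt (detXY / (delta * detY)) * L w}).
Proof.
move=> delta delta0 detXY detY bound.
have X2 := Lfun2_of_moment (measurable_funPT X) hX2.
have Y2 i := Lfun2_of_moment (measurable_funPT (Y i)) (hY2 i).
have L2 := Lfun2_of_moment (measurable_funPT L) hL2.
have uY := cov_mx_unit_sub X2 Y2 hSigma.
have Z2 := Lfun2_residual X2 Y2.
pose s2 := detXY / detY.
have ZZ : inner mu (residual mu X Y) (residual mu X Y) = s2.
  exact: inner_residual.
have s2_gt0 : 0 < s2.
  rewrite lt0r -[X in _ && (_ <= X)]ZZ inner_ge0 andbT.
  by rewrite mulf_neq0 ?invr_eq0// -unitfE -unitmxE.
pose k := Num.sqrt (detXY / (delta * detY)).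
have kE : k = Num.sqrt (s2 / delta).
  by rewrite /k invfM mulrCA mulrC.
have k0 : 0 < k by rewrite kE sqrtr_gt0 divr_gt0.
have hk : k ^+ 2 * delta = inner mu (residual mu X Y) (residual mu X Y).
  rewrite ZZ kE sqr_sqrtr; last by rewrite divr_ge0// ltW.
  by rewrite divfK// gt_eqF.
have boundE : bound = (inner mu L X + delta * k)%:E.
  rewrite /bound (expectation_density hPmu (measurable_funPT L) hL X2 L2).
  rewrite -/s2 -EFinD -ZZ -hk.
  have -> : delta * (k ^+ 2 * delta) = (delta * k) ^+ 2 by ring.
  by rewrite sqrtr_sqr gtr0_norm// mulr_gt0.
have EL := mean_density hPmu (measurable_funPT L) hL.
have Z0 := mean_residual X2 Y2.
have ZY i : inner mu (residual mu X Y) (Y i) = 0.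
  by rewrite -(inner_centeredr Z2 (Y2 i) Z0) inner_residual_cov.
have XZ D := @inner_perturbation _ _ _ mu X _ Y X2 Y2 D.
rewrite boundE; split; first exact: (opt_value_le X2 Y2 L2 EL Z2 XZ k0 hk).
split.
  exact: (tilt_ge0_of_attained X2 Y2 L2 EL Z2 XZ k0 hk).
exact: (attained_of_tilt_ge0 X2 Y2 L2 EL Z2 Z0 ZY XZ k0 hk).
Qed.
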